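(* Let $A$ be a finite-dimensional algebra over a field $k$. Then the poset $\mathsf{tors}\, A$ of torsion classes of $\mathsf{mod}\, A$, ordered by inclusion, is a complete lattice.
   Context: $\mathsf{mod}\, A$ is the category of finite-dimensional left $A$-modules. A subcategory of $\mathsf{mod}\, A$ is always full and closed under (finite) direct sums, direct summands, and isomorphisms. A torsion class in $\mathsf{mod}\, A$ is a subcategory $\mathcal T$ closed under quotients ($Y\in\mathcal T$ and $Y\twoheadrightarrow Z$ imply $Z\in\mathcal T$) and under extensions (if $0\to X\to Y\to Z\to 0$ is exact with $X,Z\in\mathcal T$, then $Y\in\mathcal T$). $\mathsf{tors}\, A$ is the set of torsion classes, ordered by inclusion. A complete lattice is a poset in which every subset has a least upper bound and a greatest lower bound. *)

(* Defs.v *)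
From mathcomp Require Import all_boot all_algebra all_field.
From Corelib Require Relation_Definitions.

Set Implicit Arguments.
Unset Strict Implicit.
Unset Printing Implicit Defensive.

Import GRing.Theory.
Local Open Scope ring_scope.

(* Finite dimension over k of the space obtained by restricting scalars
   along iota : k -> A. *)
Definition fin_dim (k : fieldType) (A : pzRingType) (iota : {rmorphism k -> A})
    (M : lmodType A) : Prop :=
  exists (n : nat) (v : 'I_n -> M), forall x : M,
    exists c : 'I_n -> k, x = \sum_(i < n) iota (c i) *: v i.

(* algType and falgType require 1 != 0. Here a k-algebra is a possibly zero ring
   A with a ring morphism from k to its center, so that the zero algebra is
   allowed; fdAlg_of_falg shows that every falgType is an instance. *)
Record fdAlgType (k : fieldType) := FdAlg {
  fdAlg_ring :> pzRingType;
  fdAlg_scalar : {rmorphism k -> fdAlg_ring};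
  fdAlg_central : forall (c : k) (a : fdAlg_ring),
    fdAlg_scalar c * a = a * fdAlg_scalar c;
  fdAlg_fin_dim : fin_dim fdAlg_scalar fdAlg_ring^o
}.

Section FalgType.
Variables (k : fieldType) (A : falgType k).

Let in_alg_central (c : k) (a : A) : in_alg A c * a = a * in_alg A c.
Proof. by rewrite /= mulr_algl mulr_algr. Qed.

Let in_alg_fin_dim : fin_dim (in_alg A) (A : pzRingType)^o.
Proof.
exists (\dim {:A}), (fun i => (vbasis {:A})`_i) => x.
exists (fun i => coord (vbasis {:A}) i x).
rewrite {1}(coord_vbasis (memvf x)); apply: eq_bigr => i _.
by rewrite /GRing.scale /= mulr_algl.
Qed.

Definition fdAlg_of_falg : fdAlgType k := FdAlg in_alg_central in_alg_fin_dim.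
End FalgType.

Record fdMod (k : fieldType) (A : fdAlgType k) := FdMod {
  fdMod_module :> lmodType A;
  fdMod_fin_dim : fin_dim (fdAlg_scalar A) fdMod_module
}.

Definition isomorphic (R : pzRingType) (M N : lmodType R) : Prop :=
  exists f : {linear M -> N}, bijective f.

Definition surjective (X Y : Type) (f : X -> Y) : Prop :=
  forall y, exists x, f x = y.

Definition short_exact (R : pzRingType) (X Y Z : lmodType R)
    (f : {linear X -> Y}) (g : {linear Y -> Z}) : Prop :=
  [/\ injective f, forall y, g y = 0 <-> exists x, f x = y & surjective g].

(* A full subcategory is given by its class of objects. The empty direct sum
   is a zero module, whence subcat_zero. *)
Record subcategory (k : fieldType) (A : fdAlgType k) (C : fdMod A -> Prop) :
    Prop := {
  subcat_iso : forall M N : fdMod A, C M -> isomorphic M N -> C N;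
  subcat_zero : forall Z : fdMod A, (forall z : Z, z = 0) -> C Z;
  subcat_sum : forall M N S : fdMod A,
    C M -> C N -> isomorphic S (M * N)%type -> C S;
  subcat_summand : forall M X Y : fdMod A,
    C M -> isomorphic M (X * Y)%type -> C X
}.

Record torsion_class (k : fieldType) (A : fdAlgType k) (T : fdMod A -> Prop) :
    Prop := {
  torsion_subcategory : subcategory T;
  torsion_quotient : forall (Y Z : fdMod A) (f : {linear Y -> Z}),
    T Y -> surjective f -> T Z;
  torsion_extension : forall (X Y Z : fdMod A)
    (f : {linear X -> Y}) (g : {linear Y -> Z}),
    short_exact f g -> T X -> T Z -> T Y
}.

Record tors (k : fieldType) (A : fdAlgType k) := Tors {
  tors_class :> fdMod A -> Prop;
  torsP : torsion_class tors_class
}.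

Definition tors_le (k : fieldType) (A : fdAlgType k) (T U : tors A) : Prop :=
  forall M : fdMod A, T M -> U M.

(* lmodType, hence tors, lives in a universe above the carriers of MathComp's
   structures, so tors cannot carry a porderType instance; posets are given
   here by a Prop-valued relation on an arbitrary type. *)
Section CompleteLattice.
Variables (P : Type) (le : P -> P -> Prop).

Definition least_upper_bound (S : P -> Prop) (x : P) : Prop :=
  (forall y, S y -> le y x) /\ (forall z, (forall y, S y -> le y z) -> le x z).

Definition greatest_lower_bound (S : P -> Prop) (x : P) : Prop :=
  (forall y, S y -> le x y) /\ (forall z, (forall y, S y -> le z y) -> le z x).

Definition complete_lattice : Prop :=
  Relation_Definitions.order P le /\
  forall S : P -> Prop,
    (exists x, least_upper_bound S x) /\ (exists x, greatest_lower_bound S x).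
End CompleteLattice.

(* Main.v *)
Require Import Defs.
From mathcomp Require Import all_boot all_algebra.
From mathcomp Require boolp.

(** The intersection of any family of torsion classes is a torsion class, so
    arbitrary meets exist; the join of a family is the meet of its upper
    bounds. *)

Section TorsionClasses.
Context {k : fieldType} {A : fdAlgType k}.
Implicit Types (S : tors A -> Prop) (T U : tors A).

(** Every defining condition of a torsion class says that membership of some modules (possibly none)
    forces membership of another, so it passes to intersections ([tors_meet_torsion]). The empty
    family causes no trouble: its intersection is all of [fdMod A]. *)

Definition tors_meet_class S (M : fdMod A) : Prop :=
  forall T, S T -> T M.

Lemma tors_meet_subcategory S : subcategory (tors_meet_class S).
Proof.
split.
- move=> M N SM MN T ST.
  exact: (subcat_iso (torsion_subcategory (torsP T)) (SM T ST) MN).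
- move=> Z Z0 T _; exact: (subcat_zero (torsion_subcategory (torsP T)) Z0).
- move=> M N X SM SN XMN T ST.
  exact: (subcat_sum (torsion_subcategory (torsP T)) (SM T ST) (SN T ST) XMN).
- move=> M X Y SM MXY T ST.
  exact: (subcat_summand (torsion_subcategory (torsP T)) (SM T ST) MXY).
Qed.

Lemma tors_meet_torsion S : torsion_class (tors_meet_class S).
Proof.
split; first exact: tors_meet_subcategory.
- move=> Y Z f SY f_surj T ST.
  exact: (torsion_quotient (torsP T) (SY T ST) f_surj).
- move=> X Y Z f g fg SX SZ T ST.
  exact: (torsion_extension (torsP T) fg (SX T ST) (SZ T ST)).
Qed.

Definition tors_meet S : tors A := Tors (tors_meet_torsion S).

Lemma tors_meetP S : greatest_lower_bound (@tors_le k A) S (tors_meet S).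
Proof.
split=> [T ST M SM | U leUS M UM T ST]; first exact: SM.
exact: leUS T ST M UM.
Qed.

(** A union of torsion classes may fail to be closed under sums or extensions, so the join is taken
    from above. *)
Definition tors_join S : tors A :=
  tors_meet (fun U => forall T, S T -> tors_le T U).

Lemma tors_joinP S : least_upper_bound (@tors_le k A) S (tors_join S).
Proof.
split=> [T ST M TM U leSU | U leSU M SM]; first exact: leSU T ST M TM.
exact: SM U leSU.
Qed.

(** Mutual inclusion gives only pointwise equivalent predicates; equality of the records comes from
    functional and propositional extensionality together with proof irrelevance. *)
Lemma tors_le_anti T U : tors_le T U -> tors_le U T -> T = U.
Proof.
case: T U => [T tT] [U tU] leTU leUT.
have eTU : T = U.
  by apply: boolp.funext => M; apply: boolp.propext; split; [exact: leTU | exact: leUT].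
(* Once [U] is replaced by [T], the two closure proofs have the same type and can be identified. *)
by case: U / eTU tU {leTU leUT} => tU; rewrite (boolp.Prop_irrelevance tT tU).
Qed.

Lemma tors_le_order : Relation_Definitions.order (tors A) (@tors_le k A).
Proof.
split=> [T M //|T U V leTU leUV M TM|]; last exact: tors_le_anti.
exact: leUV M (leTU M TM).
Qed.

End TorsionClasses.

Theorem proposition5p1 (k : fieldType) (A : fdAlgType k) :
  complete_lattice (@tors_le k A).
Proof.
split=> [|S]; first exact: tors_le_order.
split; [exists (tors_join S); exact: tors_joinP|].
by exists (tors_meet S); exact: tors_meetP.
Qed.
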